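(* Let $\mathbb{K}$ be a field of characteristic zero, $S=\mathbb{K}[x_1,\dots,x_l]$, and let $\mathcal{A}$ be a central hyperplane arrangement in $\mathbb{K}^l$ which is plus-one generated. Then for every $X\in L(\mathcal{A})$, the localization $\mathcal{A}_X$ is free or plus-one generated.
   Context: A central arrangement $\mathcal{A}=\{H_1,\dots,H_n\}$ in $\mathbb{K}^l$ is a finite set of hyperplanes through the origin, $H_i=\alpha_i^{-1}(0)$ with $\alpha_i\in S$ linear forms; $Q(\mathcal{A})=\prod_i\alpha_i$. The intersection lattice is $L(\mathcal{A})=\{\bigcap_{H\in\mathcal{B}}H\mid \mathcal{B}\subseteq\mathcal{A}\}$ (the empty intersection being $\mathbb{K}^l$). For $X\in L(\mathcal{A})$ the localization is $\mathcal{A}_X=\{H\in\mathcal{A}\mid X\subseteq H\}$, regarded as an arrangement in $\mathbb{K}^l$. The module of logarithmic vector fields is $D(\mathcal{A})=\{\delta=\sum_i f_i\partial_{x_i}\mid f_i\in S,\ \delta(\alpha_i)\in\alpha_i S\ \forall i\}$, a graded $S$-module (a derivation with all $f_i$ homogeneous of degree $e$ has degree $e$). $\mathcal{A}$ is free if $D(\mathcal{A})$ is a free $S$-module. $\mathcal{A}$ is plus-one generated with exponents $(d_1,\dots,d_l)$ and level $d$ if $D(\mathcal{A})$ has a minimal graded free resolution of the form $0\to S(-d-1)\xrightarrow{(\alpha,f_1,\dots,f_l)} S(-d)\oplus\bigoplus_{i=1}^l S(-d_i)\to D(\mathcal{A})\to 0$; $\mathcal{A}$ is plus-one generated if this holds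 for some $(d_1,\dots,d_l)$ and $d$.
   Formalization: The linear form α in the resolution defining ''plus-one generated'' is required to be nonzero, in both hypothesis and conclusion; if α = 0 is admitted the claim fails (e.g. a product of a suitable 7-line arrangement in K^3 with 6 lines in K^2). *)

(* Defs.v *)
From HB Require Import structures.
From mathcomp Require Import all_boot all_order all_algebra.
From mathcomp Require Import finmap.
From mathcomp Require Import mpoly.

Set Implicit Arguments.
Unset Strict Implicit.
Unset Printing Implicit Defensive.

Import GRing.Theory.

Local Open Scope ring_scope.

Section Arrangements.

Variables (K : fieldType) (l : nat).

Local Notation S := {mpoly K[l]}.
Local Notation V := 'rV[K]_l.

(* An arrangement is a finite set of subspaces of K^l (points are row vectors),
   all of which are hyperplanes. *)
Definition central_arrangement (A : {fset {vspace V}}) : Prop :=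
  forall H, H \in A -> (\dim H).+1 = l.

Definition in_intersection_lattice (A : {fset {vspace V}}) (X : {vspace V}) :
    Prop :=
  exists2 B : {fset {vspace V}}, (B `<=` A)%fset & X = (\bigcap_(H <- B) H)%VS.

Definition localization (A : {fset {vspace V}}) (X : {vspace V}) :
    {fset {vspace V}} :=
  [fset H in A | (X <= H)%VS]%fset.

(* alpha is a linear form with alpha^{-1}(0) = H. *)
Definition defines (alpha : S) (H : {vspace V}) : Prop :=
  alpha \is 1.-homog /\
  forall x : V, x \in H <-> alpha.@[fun i => x 0 i] = 0.

(* The derivation sum_i f_i d/dx_i is encoded by the row of its coefficients. *)
Definition derivation_apply (delta : 'rV[S]_l) (p : S) : S :=
  \sum_(i < l) delta 0 i * p^`M(i).

(* A form defining a given hyperplane is unique up to a nonzero scalar, so the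
   quantification over alpha amounts to fixing one form for each H. *)
Definition log_derivation (A : {fset {vspace V}}) (delta : 'rV[S]_l) : Prop :=
  forall (H : {vspace V}) (alpha : S), H \in A -> defines alpha H ->
    exists q : S, derivation_apply delta alpha = q * alpha.

(* D(A) has an S-basis (the rows of B). D(A) is contained in S^l with S
   Noetherian, so that a basis is necessarily finite. *)
Definition free_arrangement (A : {fset {vspace V}}) : Prop :=
  exists (r : nat) (B : 'M[S]_(r, l)),
    [/\ forall i, log_derivation A (row i B),
        forall delta, log_derivation A delta ->
          exists u : 'rV[S]_r, delta = u *m B
      & forall u : 'rV[S]_r, u *m B = 0 -> u = 0].

(* M is the matrix, acting on the right of row vectors, of a degree-0 graded
   map bigoplus_i S(- a_i) -> bigoplus_j S(- b_j). The second clause is needed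
   because the subtraction of natural numbers is truncated. *)
Definition graded_mx (m n : nat) (a : 'rV[nat]_m) (b : 'rV[nat]_n)
    (M : 'M[S]_(m, n)) : Prop :=
  forall i j,
    M i j \is (a ord0 i - b ord0 j)%N.-homog /\ ((a ord0 i < b ord0 j)%N -> M i j = 0).

(* 0 -> bigoplus_i S(- a_i) --phi--> bigoplus_j S(- b_j) --theta--> D(A) -> 0
   is a minimal graded free resolution of D(A), where D(A) is graded as a
   submodule of S^l. *)
Definition minimal_graded_resolution (A : {fset {vspace V}}) (m n : nat)
    (a : 'rV[nat]_m) (b : 'rV[nat]_n)
    (phi : 'M[S]_(m, n)) (theta : 'M[S]_(n, l)) : Prop :=
  [/\ graded_mx a b phi,
      (forall j k, theta j k \is (b ord0 j).-homog) /\
        (forall j, log_derivation A (row j theta)),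
      (forall delta, log_derivation A delta ->
         exists u : 'rV[S]_n, delta = u *m theta) /\
        (forall u : 'rV[S]_n,
           u *m theta = 0 <-> exists v : 'rV[S]_m, u = v *m phi),
      forall v : 'rV[S]_m, v *m phi = 0 -> v = 0
    & (* minimality: phi maps into the maximal ideal (x_1, ..., x_l) times its
         target *)
      forall i j, (phi i j)@_0%MM = 0].

(* alpha is the equation of a hyperplane, hence nonzero; that it has degree 1 is part of graded_mx. All degrees are natural
   numbers since D(A) vanishes in negative degrees. *)
Definition plus_one_generated_with (A : {fset {vspace V}})
    (e : 'rV[nat]_l) (d : nat) : Prop :=
  exists (alpha : S) (f : 'rV[S]_l) (theta : 'M[S]_(1 + l, l)),
    alpha != 0 /\
    minimal_graded_resolution A (const_mx d.+1 : 'rV[nat]_1)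
      (row_mx (const_mx d : 'rV[nat]_1) e)
      (row_mx (const_mx alpha : 'M[S]_1) f) theta.

Definition plus_one_generated (A : {fset {vspace V}}) : Prop :=
  exists (e : 'rV[nat]_l) (d : nat), plus_one_generated_with A e d.

End Arrangements.

(* Main.v *)
(* Choose p in X off the hyperplanes of A that do not contain X.  After the
   translation by p, a product s of forms defining the latter has s(0) != 0, and
   s D(A_X) is contained in the translate of D(A), itself contained in D(A_X).
   Comparing homogeneous components with respect to 0, one sees that D(A_X) is
   generated by at most l + 1 homogeneous elements.  If l suffice they form a
   basis; otherwise the matrix expressing the l + 1 translated generators of D(A)
   in terms of minimal generators is invertible at 0, the same comparison applied
   to the syzygies shows that they are generated by one homogeneous syzygy g, and
   the linear form alpha of the relation for D(A) forces g to have an entry of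
   degree one. *)
Require Import Defs.
From HB Require Import structures.
From mathcomp Require Import all_boot all_order all_algebra.
From mathcomp Require Import fingroup perm.
From mathcomp Require Import finmap.
From mathcomp Require Import mpoly.
From Stdlib Require Import Classical.

Set Implicit Arguments.
Unset Strict Implicit.
Unset Printing Implicit Defensive.

Import GRing.Theory.

Local Open Scope ring_scope.

(** * Homogeneous components and minimal generators of graded submodules of free modules *)

Section GradedModules.

Variables (K : fieldType) (l : nat).

Local Notation S := {mpoly K[l]}.

Lemma pihomog0E (p : S) : pihomog mdeg 0 p = (p@_0%MM)%:MP.
Proof.
rewrite {2}[p](mpolyE p) raddf_sum /= raddf_sum /= pihomogE big_mkcond /=.
apply: eq_bigr => m _; rewrite mcoeffZ mcoeffX mdeg_eq0 eq_sym.
have [<-|_] := eqVneq; first by rewrite mpolyX0 alg_mpolyC mulr1.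
by rewrite mulr0 mpolyC0.
Qed.

(** Multiplying by a form of degree [d] shifts degrees by [d], so only the component of [p] in
    degree [e - d] contributes. The test keeps truncated subtraction from inventing a component when
    [e < d]. *)
Lemma pihomogM_homog e d (p q : S) : q \is d.-homog ->
  pihomog mdeg e (p * q) =
  if (d <= e)%N then pihomog mdeg (e - d) p * q else 0.
Proof.
move=> hq; pose k := maxn (msize p) e.+1.
have hk : (msize p <= k)%N by rewrite leq_maxl.
have hek : (e < k)%N by rewrite leq_maxr.
rewrite {1}(pihomog_partitionE hk) mulr_suml raddf_sum /=.
have hM i : pihomog mdeg i p * q \is (i + d).-homog.
  by apply: dhomogM => //; apply: pihomogP.
have [de|de] := leqP d e; last first.
  rewrite big1 // => i _; apply: pihomog_ne0 (hM i).
  by rewrite gtn_eqF // (leq_trans de) // leq_addl.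
have hi : (e - d < k)%N by rewrite (leq_ltn_trans (leq_subr _ _)).
rewrite (bigD1 (Ordinal hi)) //= pihomog_dE; last first.
  by have := hM (e - d)%N; rewrite subnK.
rewrite big1 ?addr0 // => i ni; apply: pihomog_ne0 (hM i).
by apply: contra ni => /eqP ide; apply/eqP/val_inj; rewrite /= -ide addnK.
Qed.

(** The degree [e] component in the direct sum of the shifted modules S(-b_j). *)
Definition graded_part (n : nat) (b : 'rV[nat]_n) (e : nat)
    (delta : 'rV[S]_n) : 'rV[S]_n :=
  \row_j if (b 0%R j <= e)%N then pihomog mdeg (e - b 0%R j) (delta 0 j) else 0.

Lemma graded_part_homog n (b : 'rV_n) e delta :
  graded_mx (const_mx e : 'rV_1) b (graded_part b e delta).
Proof.
move=> i j; rewrite (ord1 i) !mxE; split.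
  by case: ifP => _; [apply: pihomogP | apply: dhomog0].
by rewrite ltnNge => /negbTE->.
Qed.

Lemma graded_part0 n (b : 'rV_n) e : graded_part b e 0 = 0.
Proof. by apply/rowP => j; rewrite !mxE raddf0 if_same. Qed.

(** A graded matrix is a map of degree 0, hence commutes with taking components. *)
Lemma graded_part_mulmx m n (a : 'rV_m) (b : 'rV_n) e (w : 'rV[S]_m)
    (h : 'M_(m, n)) : graded_mx a b h ->
  graded_part b e (w *m h) = graded_part a e w *m h.
Proof.
move=> gh; apply/rowP => j; rewrite !mxE raddf_sum /=.
under [RHS]eq_bigr => i _ do rewrite !mxE.
have [be|be] := leqP (b 0 j) e; last first.
  rewrite big1 // => i _; case: ifP => [ae|]; last by rewrite mul0r.
  by have [_ ->] := gh i j; rewrite ?mulr0 // (leq_ltn_trans ae).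
apply: eq_bigr => i _; have [hij zij] := gh i j.
have [ab|ba] := ltnP (a 0 i) (b 0 j); first by rewrite zij // !mulr0 raddf0.
rewrite (pihomogM_homog _ _ hij) leq_subLR subnKC // subnBA // subnK //.
by case: ifP; rewrite ?mul0r.
Qed.

Lemma graded_part_sum n (b : 'rV_n) (delta : 'rV_n) :
  exists D, forall k, (D <= k)%N ->
  delta = \sum_(e < k) graded_part b e delta.
Proof.
exists (\max_j (msize (delta 0%R j) + b 0%R j))%N => k hk.
apply/rowP => j; rewrite summxE.
under eq_bigr => e _ do rewrite mxE.
have hj : (msize (delta 0%R j) + b 0%R j <= k)%N.
  exact: leq_trans (leq_bigmax j) hk.
have hb : (b 0%R j <= k)%N by exact: leq_trans (leq_addl _ _) hj.
(* Degrees below [b 0 j] contribute zero; reindexing from there leaves the usual homogeneous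
   decomposition of the entry. *)
rewrite -(big_mkord xpredT
  (fun e => if (b 0%R j <= e)%N
            then pihomog mdeg (e - b 0%R j) (delta 0 j) else 0)).
rewrite (big_cat_nat _ hb) //= big_nat_cond big1 ?add0r; last first.
  by move=> e /andP[/andP[_]]; rewrite ltnNge => /negbTE->.
rewrite -[X in \sum_(X <= _ < _) _]add0n big_addn big_mkord.
under eq_bigr => e _ do rewrite leq_addl addnK.
by apply: pihomog_partitionE; rewrite leq_subRL // addnC.
Qed.

Definition graded_submodule n (b : 'rV[nat]_n) (M : 'rV[S]_n -> Prop) : Prop :=
  [/\ M 0, forall (c : S) u v, M u -> M v -> M (c *: u + v)
    & forall e u, M u -> M (graded_part b e u)].

Definition generates n r (M : 'rV[S]_n -> Prop) (h : 'M[S]_(r, n)) : Prop :=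
  (forall i, M (row i h)) /\ forall u, M u -> exists w : 'rV[S]_r, u = w *m h.

Lemma mulmx_rows m n r (A : 'M[S]_(m, n)) (h : 'M_(r, n)) :
  (forall i, exists w : 'rV_r, row i A = w *m h) -> exists U, A = U *m h.
Proof.
case/fin_all_exists => w hw; exists (\matrix_i w i).
by apply/row_matrixP => i; rewrite row_mul rowK.
Qed.

(* For u homogeneous of degree e, the part of degree e of [s *: u] is [s(0) *: u];
   hence the homogeneous parts of the rows of theta generate M. *)
Lemma generated_by_homogeneous n (b : 'rV[nat]_n) (M : 'rV[S]_n -> Prop) k
    (theta : 'M[S]_(k, n)) (s : S) :
  graded_submodule b M -> (forall i, M (row i theta)) -> s@_0%MM != 0 ->
  (forall u, M u -> exists w : 'rV_k, s *: u = w *m theta) ->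
  exists r (a : 'rV_r) (h : 'M_(r, n)), graded_mx a b h /\ generates M h.
Proof.
move=> gM Mtheta s0 hs; have [_ ML Mpart] := gM.
have [D hD] : exists D, forall i,
    row i theta = \sum_(e < D) graded_part b e (row i theta).
  have [D hD] := fin_all_exists (fun i => graded_part_sum b (row i theta)).
  by exists (\max_i D i)%N => i; apply: hD; apply: leq_bigmax.
pose F (t : 'I_k * 'I_D) := graded_part b t.2 (row t.1 theta).
pose h : 'M[S]_(#|{: 'I_k * 'I_D}|, n) := \matrix_i F (enum_val i).
pose a : 'rV[nat]_#|{: 'I_k * 'I_D}| := \row_i val (enum_val i).2.
have gh : graded_mx a b h.
  move=> i j; have := graded_part_homog b (enum_val i).2
    (row (enum_val i).1 theta) 0 j.
  by rewrite !mxE.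
have Mh i : M (row i h) by rewrite rowK; apply: Mpart.
have [U hU] : exists U, theta = U *m h.
  (* The witness selects the pairs whose first index is [i], thus summing the components of row
     [i]. *)
  apply: mulmx_rows => i; exists (\row_t ((enum_val t).1 == i)%:R).
  rewrite mulmx_sum_row hD.
  under [RHS]eq_bigr => t _ do rewrite mxE rowK.
  rewrite -(big_enum_val (fun t : 'I_k * 'I_D => (t.1 == i)%:R *: F t)) /=.
  rewrite -(pair_bigA _ (fun x y => (x == i)%:R *: F (x, y))) /=.
  rewrite (bigD1 i) //= [X in _ + X]big1 ?addr0 => [|x /negbTE xi].
    by apply: eq_bigr => e _; rewrite eqxx scale1r.
  by rewrite big1 // => e _; rewrite xi scale0r.
exists _, a, h; split=> //; split=> // u Mu.
have hpart e : exists w : 'rV_#|{: 'I_k * 'I_D}|, graded_part b e u = w *m h.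
  have [w hw] := hs _ (Mpart e _ Mu).
  have := congr1 (graded_part b e) hw.
  rewrite hU mulmxA (graded_part_mulmx _ _ gh) -mul_scalar_mx.
  (* The component of [u] is read as a one-row graded matrix with source degree [e], so in degree
     [e] it only meets the constant term of [s]. *)
  rewrite (graded_part_mulmx _ _ (graded_part_homog b e u)).
  rewrite [graded_part _ _ s%:M]mx11_scalar !mxE leqnn subnn mulr1n pihomog0E.
  rewrite mul_scalar_mx => hsu.
  exists ((s@_0%MM)^-1%:MP *: graded_part a e (w *m U)).
  by rewrite -scalemxAl -hsu scalerA -mpolyCM mulVf // scale1r.
have [k' hk'] := graded_part_sum b u.
have [w hw] := fin_all_exists (fun e : 'I_k' => hpart e).
exists (\sum_e w e); rewrite {1}(hk' k') // mulmx_suml.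
by apply: eq_bigr.
Qed.

Local Notation at0 := (map_mx (mcoeff (R := K) (n := l) 0%MM)).

(** The rows of [s%:M - W *m U] are syzygies of [h], and these have no constant terms. *)
Lemma minimal_generators_at0 n r k (h : 'M[S]_(r, n)) (theta : 'M_(k, n))
    (U : 'M_(k, r)) (W : 'M_(r, k)) (s : S) :
  (forall w : 'rV_r, w *m h = 0 -> forall i, (w 0 i)@_0%MM = 0) ->
  theta = U *m h -> s *: h = W *m theta ->
  at0 W *m at0 U = (s@_0%MM)%:M.
Proof.
move=> minh -> /eqP; rewrite -subr_eq0 mulmxA -mul_scalar_mx -mulmxBl => /eqP E.
rewrite -map_mxM -(map_scalar_mx (mcoeff 0%MM)); apply/matrixP => i j.
have /minh/(_ j) : row i (s%:M - W *m U) *m h = 0 by rewrite -row_mul E row0.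
rewrite mxE mxE [X in _ + X]mxE mcoeffB => /subr0_eq Eij.
by rewrite [LHS]mxE [RHS]mxE; apply: esym.
Qed.

(** At the origin, a nonzero scalar matrix of size [r] factors through a space of dimension [k]. *)
Lemma minimal_generators_le n r k (h : 'M[S]_(r, n)) (theta : 'M_(k, n))
    (U : 'M_(k, r)) (W : 'M_(r, k)) (s : S) :
  (forall w : 'rV_r, w *m h = 0 -> forall i, (w 0 i)@_0%MM = 0) ->
  theta = U *m h -> s *: h = W *m theta -> s@_0%MM != 0 -> (r <= k)%N.
Proof.
move=> minh hU hW s0; have E := minimal_generators_at0 minh hU hW.
have <- : \rank (at0 W *m at0 U) = r by rewrite E -scalemx1 mxrank_scale_nz ?mxrank1.
exact: leq_trans (mxrankM_maxl _ _) (rank_leq_col _).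
Qed.

(** A form of graded Nakayama: among finite homogeneous generating families, one with the fewest
    members admits no syzygy with a nonzero constant term. *)
Lemma minimal_generators n (b : 'rV[nat]_n) (M : 'rV[S]_n -> Prop) k
    (theta : 'M[S]_(k, n)) (s : S) :
  graded_submodule b M -> (forall i, M (row i theta)) -> s@_0%MM != 0 ->
  (forall u, M u -> exists w : 'rV_k, s *: u = w *m theta) ->
  exists r (a : 'rV_r) (h : 'M_(r, n)),
    [/\ (r <= k)%N, graded_mx a b h, generates M h
      & forall w : 'rV_r, w *m h = 0 -> forall i, (w 0 i)@_0%MM = 0].
Proof.
move=> gM Mtheta s0 hs.
pose P r := exists (a : 'rV_r) (h : 'M_(r, n)), graded_mx a b h /\ generates M h.
have [r [Pr minr]] : exists r, P r /\ forall q, P q -> (r <= q)%N.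
  have [r Pr] : exists r, P r by apply: generated_by_homogeneous Mtheta s0 hs.
  elim/ltn_ind: r Pr => r IH Pr.
  have [[q [qr Pq]]|hn] := classic (exists q, (q < r)%N /\ P q).
    exact: IH Pq.
  exists r; split=> // q Pq; rewrite leqNgt; apply/negP => qr.
  by apply: hn; exists q.
have [a [h [gh [Mh hh]]]] := Pr.
suff minh : forall w : 'rV_r, w *m h = 0 -> forall i, (w 0 i)@_0%MM = 0.
  exists r, a, h; split=> //.
  have [U hU] := mulmx_rows (fun i => hh _ (Mtheta i)).
  have [i|W hW] := @mulmx_rows _ _ _ (s *: h) theta.
    by have [w hw] := hs _ (Mh i); exists w; rewrite -hw linearZ.
  exact: minimal_generators_le hU hW s0.
(* A syzygy with a nonzero constant term in position i has a graded part whose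
   i-th entry is that constant, which makes the i-th generator redundant. *)
move=> w wh0 i; apply/eqP; apply: contraT => wi0.
have := congr1 (graded_part b (a 0 i)) wh0.
rewrite (graded_part_mulmx _ _ gh) graded_part0.
set w' := graded_part _ _ _ => wh'.
have w'i : w' 0 i = ((w 0 i)@_0%MM)%:MP by rewrite mxE leqnn subnn pihomog0E.
clearbody w'.
case: r a h gh Mh hh i w wh0 wi0 w' wh' w'i Pr minr =>
  [|r] a h gh Mh hh i w _ wi0 w' wh' w'i _ minr; first by case: i {wi0 w'i}.
suff /minr : P r by rewrite ltnn.
exists (col' i a), (row' i h); split.
  by move=> x y; rewrite !mxE; apply: gh.
split=> [x|u /hh[v ->]]; first by rewrite row_rowsub; apply: Mh.
pose c := (w 0 i)@_0%MM; have c0 : c^-1 * c = 1 by rewrite mulVf.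
(* Subtracting this multiple of the syzygy [w'] cancels coordinate [i] without changing the product
   with [h]. *)
exists (col' i (v - (c^-1%:MP * v 0 i) *: w')).
have -> : v *m h = (v - (c^-1%:MP * v 0 i) *: w') *m h.
  by rewrite mulmxBl -scalemxAl wh' scaler0 subr0.
set z := _ - _; have zi : z 0 i = 0.
  by rewrite !mxE w'i mulrAC -mpolyCM c0 mul1r subrr.
apply/rowP => j; rewrite !mxE (bigD1_ord i) //= zi mul0r add0r.
by apply: eq_bigr => x _; rewrite !mxE.
Qed.

End GradedModules.

(** * Linear forms, defining equations of subspaces and generic points *)

Section LinearForms.

Variables (K : fieldType) (l : nat).

Local Notation S := {mpoly K[l]}.
Local Notation V := 'rV[K]_l.

Lemma linear_form_coef (alpha : S) :
  alpha \is 1.-homog -> alpha = \sum_i alpha@_U_(i) *: 'X_i.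
Proof.
move=> /dhomogP h1; apply/mpolyP => m; rewrite raddf_sum /=.
under eq_bigr => i _ do rewrite mcoeffZ mcoeffX.
have [/eqP/mdeg1P[i /eqP mi]|m1] := eqVneq (mdeg m) 1%N.
  rewrite mi (bigD1 i) //= eqxx mulr1 big1 ?addr0 // => j ji.
  by rewrite eq_mnm1 (negbTE ji) mulr0.
rewrite big1 => [|i _].
  by apply: memN_msupp_eq0; apply/negP => /h1 /eqP; rewrite (negbTE m1).
by case: eqP => [im|_]; rewrite ?mulr0 //; rewrite -im mdeg1 in m1.
Qed.

Lemma linear_form_eval (alpha : S) (x : 'I_l -> K) :
  alpha \is 1.-homog -> alpha.@[x] = \sum_i alpha@_U_(i) * x i.
Proof.
move=> /linear_form_coef {1}->; rewrite raddf_sum /=.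
by apply: eq_bigr => i _; rewrite mevalZ mevalXU.
Qed.

Lemma linear_form_deriv (alpha : S) i :
  alpha \is 1.-homog -> alpha^`M(i) = (alpha@_U_(i))%:MP.
Proof.
move=> /linear_form_coef {1}->; rewrite raddf_sum /= (bigD1 i) //=.
rewrite mderivZ mderivX mnm1E eqxx scale1r.
have -> : (U_(i) - U_(i) = 0)%MM by apply/mnmP => j; rewrite mnmBE subnn mnm0E.
rewrite mpolyX0 alg_mpolyC big1 ?addr0 // => j ji.
by rewrite mderivZ mderivX mnm1E (negbTE ji) scale0r scaler0.
Qed.

Lemma defines_neq0 (alpha : S) H : H != fullv -> defines alpha H -> alpha != 0.
Proof.
move=> Hf [_ hH]; apply: contraNneq Hf => a0.
rewrite eqEsubv subvf; apply/subvP => x _; apply/hH.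
by rewrite a0 meval0.
Qed.

(** The ratio is read off at one point [x] outside [H]; each basis vector, corrected by a multiple
    of [x], falls into [H], where both forms vanish. *)
Lemma defines_proportional (alpha beta : S) H : H != fullv ->
  defines alpha H -> defines beta H -> exists c : K, alpha = c *: beta.
Proof.
move=> Hf [ha Ha] [hb Hb].
have [x xH] : exists x, x \notin H.
  have /subvPn[x _ xH] : ~~ (fullv <= H)%VS
    by apply: contra Hf; rewrite eqEsubv subvf.
  by exists x.
have bx : beta.@[fun i => x 0 i] != 0 by apply: contra xH => /eqP /Hb.
pose c := alpha.@[fun i => x 0 i] / beta.@[fun i => x 0 i]; exists c.
rewrite (linear_form_coef ha) (linear_form_coef hb) scaler_sumr.
have ev (gamma : S) (y : V) i : gamma \is 1.-homog ->
    gamma.@[fun j => (delta_mx 0 i - y) 0 j] =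
    gamma@_U_(i) - gamma.@[fun j => y 0 j].
  move=> hg; rewrite !linear_form_eval //.
  have -> : gamma@_U_(i) = \sum_j gamma@_U_(j) * (j == i)%:R.
    rewrite (bigD1 i) //= eqxx mulr1 big1 ?addr0 // => j /negbTE->.
    by rewrite mulr0.
  by rewrite -sumrB; apply: eq_bigr => j _; rewrite !mxE mulrBr.
have evZ (gamma : S) t : gamma \is 1.-homog ->
    gamma.@[fun j => (t *: x) 0 j] = t * gamma.@[fun j => x 0 j].
  move=> hg; rewrite !linear_form_eval // mulr_sumr.
  by apply: eq_bigr => j _; rewrite !mxE mulrCA.
apply: eq_bigr => i _; rewrite scalerA; congr (_ *: _).
set t := beta@_U_(i) / beta.@[fun j => x 0 j].
have /Ha : delta_mx 0 i - t *: x \in H.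
  by apply/Hb; rewrite ev // evZ // divfK // subrr.
rewrite ev // evZ // => /subr0_eq ->.
by rewrite /t /c mulrC mulrA mulrAC.
Qed.

Lemma multiple_of_defining_forms (s : seq {vspace V}) :
  (forall H, H \in s -> H != fullv) ->
  exists Q : S, [/\ Q != 0,
    forall H alpha, H \in s -> defines alpha H -> exists q, Q = q * alpha
    & forall x : V, (forall H, H \in s -> x \notin H) ->
        Q.@[fun i => x 0 i] != 0].
Proof.
elim: s => [|H s IH] hs.
  by exists 1; split; rewrite ?oner_neq0 // => x _; rewrite meval1 oner_neq0.
have [Q [Q0 Qdiv Qev]] : exists Q : S, _ :=
  IH (fun G Gs => hs G (mem_behead (s := H :: s) Gs)).
have Hf : H != fullv by rewrite hs ?mem_head.
have [[beta hb]|nb] := classic (exists beta : S, defines beta H).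
  exists (beta * Q); split.
  - by rewrite mulf_neq0 // (defines_neq0 Hf hb).
  - move=> G alpha; rewrite inE => /orP[/eqP-> ha|Gs ha].
      have [c ->] := defines_proportional Hf hb ha.
      by exists (c *: Q); rewrite -scalerAl -scalerAl mulrC.
    by have [q ->] := Qdiv _ _ Gs ha; exists (beta * q); rewrite mulrA.
  - move=> x hx; rewrite mevalM mulf_neq0 //.
      by apply: contra (hx H (mem_head _ _)) => /eqP /(proj2 hb).
    by apply: Qev => G Gs; apply: hx; rewrite inE Gs orbT.
(* If no form defines [H], then [H] imposes no divisibility and the old [Q] still serves. *)
exists Q; split=> // [G alpha|x hx].
  by rewrite inE => /orP[/eqP-> ha|/Qdiv]; [case: nb; exists alpha | apply].
by apply: Qev => G Gs; apply: hx; rewrite inE Gs orbT.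
Qed.

(** Given [p] in [X] off the earlier subspaces and [q] in [X] off the new one, the points
    [q + p *+ n] avoid each of them for large [n]: two such points in [G] would put [p], and then
    [q], in [G]. *)
Lemma generic_point (s : seq {vspace V}) (X : {vspace V}) :
  [pchar K] =i pred0 -> (forall H, H \in s -> ~~ (X <= H)%VS) ->
  exists2 p, p \in X & forall H, H \in s -> p \notin H.
Proof.
move=> charK; elim: s => [|H s IH] hs; first by exists 0; rewrite ?mem0v.
have [p pX hp] := IH (fun G Gs => hs G (mem_behead (s := H :: s) Gs)).
have /subvPn[q qX qH] := hs H (mem_head _ _).
have bad (G : {vspace V}) : p \notin G \/ q \notin G ->
    exists N : nat, forall n, (N <= n)%N -> q + p *+ n \notin G.
  move=> hG; have [[n hn]|hn] := classic (exists n, q + p *+ n \in G).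
    exists n.+1 => m nm; apply/negP => hm.
    have pG : p \in G.
      have : p *+ (m - n) \in G.
        rewrite mulrnBr ?(ltnW nm) //.
        by have := rpredB hm hn; rewrite opprD addrACA subrr add0r.
      (* Characteristic zero makes the positive integer [m - n] invertible. *)
      rewrite -scaler_nat => /(memvZ (m - n)%:R^-1); rewrite scalerA mulVf.
        by rewrite scale1r.
      by rewrite ((pcharf0P _).1 charK) subn_eq0 -ltnNge.
    case: hG => [|/negP]; first by rewrite pG.
    by apply; rewrite -(rpredDr _ (rpredMn n pG)).
  by exists 0%N => n _; apply/negP => hm; apply: hn; exists n.
have [N hN] : exists N, forall (G : {vspace V}) n, G \in H :: s -> (N <= n)%N ->
    q + p *+ n \notin G.
  have hb (G : {vspace V}) : G \in H :: s -> p \notin G \/ q \notin G.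
    by rewrite inE => /orP[/eqP->|/hp]; [right | left].
  elim: (H :: s) hb => [|G t IHt] hb; first by exists 0%N.
  have [N hN] := IHt (fun F Ft => hb F (mem_behead (s := G :: t) Ft)).
  have [N' hN'] := bad G (hb G (mem_head _ _)).
  exists (maxn N N') => F n; rewrite inE geq_max => /orP[/eqP->|Ft] /andP[h1 h2].
    exact: hN'.
  exact: hN.
by exists (q + p *+ N) => [|G Gs]; [rewrite rpredD ?rpredMn | apply: hN].
Qed.

End LinearForms.

(** * Grading and translation of logarithmic derivations *)

Section LogDerivations.

Variables (K : fieldType) (l : nat).

Local Notation S := {mpoly K[l]}.
Local Notation V := 'rV[K]_l.
Local Notation arrangement := {fset {vspace V}}.

Lemma derivation_apply_linear (alpha : S) (c : S) (u v : 'rV[S]_l) :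
  derivation_apply (c *: u + v) alpha =
  c * derivation_apply u alpha + derivation_apply v alpha.
Proof.
rewrite /derivation_apply mulr_sumr -big_split /=.
by apply: eq_bigr => i _; rewrite !mxE mulrDl mulrA.
Qed.

Lemma derivation_applyZ (alpha : S) (c : S) (u : 'rV[S]_l) :
  derivation_apply (c *: u) alpha = c * derivation_apply u alpha.
Proof.
by rewrite /derivation_apply mulr_sumr; apply: eq_bigr => i _; rewrite !mxE mulrA.
Qed.

(** The partial derivatives of a linear form are constants, so applying a derivation to it commutes
    with taking components. *)
Lemma log_derivation_graded (A : arrangement) :
  graded_submodule (const_mx 0%N : 'rV_l) (log_derivation A).
Proof.
split=> [H alpha _ _|c u v Mu Mv H alpha HA ha|e u Mu H alpha HA ha].
- exists 0; rewrite mul0r /derivation_apply big1 // => i _.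
  by rewrite mxE mul0r.
- have [q hq] := Mu H alpha HA ha; have [r hr] := Mv H alpha HA ha.
  by exists (c * q + r); rewrite derivation_apply_linear hq hr mulrDl mulrA.
- have [q hq] := Mu H alpha HA ha; have [h1 _] := ha.
  have -> : derivation_apply (graded_part (const_mx 0%N) e u) alpha =
      pihomog mdeg e (derivation_apply u alpha).
    rewrite /derivation_apply raddf_sum /=; apply: eq_bigr => i _.
    rewrite !mxE /= subn0 linear_form_deriv //.
    by rewrite mulrC mul_mpolyC mulrC mul_mpolyC linearZ.
  rewrite hq (pihomogM_homog _ _ h1).
  by case: ifP => _; [eexists | exists 0; rewrite mul0r].
Qed.

(** The shift q(x) -> q(x + p), which brings the point [p] to the origin. *)
Definition translate (p : V) : S -> S :=
  comp_mpoly [tuple 'X_i + (p 0 i)%:MP | i < l].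

HB.instance Definition _ p := GRing.RMorphism.on (translate p).

Lemma translateC p c : translate p c%:MP = c%:MP.
Proof. exact: comp_mpolyC. Qed.

Lemma translate_at0 p q : (translate p q)@_0%MM = q.@[fun i => p 0 i].
Proof.
have ev0 (r : S) : r@_0%MM = r.@[fun=> 0].
  rewrite {2}[r]mpolyE {1}[r]mpolyE !raddf_sum /=; apply: eq_bigr => m _.
  rewrite mcoeffZ mcoeffX mevalZ mevalX; congr (_ * _).
  have [->|m0] := eqVneq m 0%MM.
    by rewrite big1 // => i _; rewrite mnm0E expr0.
  have [i mi] : exists i, m i != 0%N.
    apply/existsP; apply: contraR m0 => /existsPn h; apply/eqP/mnmP => i.
    by rewrite mnm0E; apply/eqP; rewrite -[_ == _]negbK h.
  by rewrite (bigD1 i) //= expr0n (negbTE mi) mul0r.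
rewrite ev0 comp_mpoly_meval; apply: meval_eq => i.
by rewrite tnth_mktuple mevalD mevalXU mevalC add0r.
Qed.

Lemma translateK p : cancel (translate p) (translate (- p)).
Proof.
move=> q; rewrite [in LHS](mpolyE q) [RHS]mpolyE.
rewrite (raddf_sum (translate p)) (raddf_sum (translate (- p))) /=.
apply: eq_bigr => m _; rewrite /translate !comp_mpolyZ; congr (_ *: _).
rewrite comp_mpolyX rmorph_prod /= [RHS]mpolyXE_id; apply: eq_bigr => i _.
rewrite tnth_mktuple rmorphXn /= raddfD /= comp_mpolyC comp_mpolyXU.
by rewrite -tnth_nth tnth_mktuple mxE mpolyCN addrNK.
Qed.

Lemma translate_linear_form p (alpha : S) : alpha \is 1.-homog ->
  translate p alpha = alpha + (alpha.@[fun i => p 0 i])%:MP.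
Proof.
move=> ha; rewrite linear_form_eval // {1 2}(linear_form_coef ha).
rewrite /translate !raddf_sum -big_split /=; apply: eq_bigr => i _.
rewrite comp_mpolyZ comp_mpolyXU -tnth_nth tnth_mktuple scalerDr.
by rewrite mpolyCM mul_mpolyC.
Qed.

(** Only the coefficients of the derivation need translating: the derivatives of [alpha] are
    constants, fixed by translation. *)
Lemma derivation_translate p (u : 'rV[S]_l) (alpha : S) : alpha \is 1.-homog ->
  derivation_apply (map_mx (translate p) u) alpha =
  translate p (derivation_apply u alpha).
Proof.
move=> ha; rewrite /derivation_apply raddf_sum /=; apply: eq_bigr => i _.
by rewrite mxE linear_form_deriv // rmorphM /= translateC.
Qed.

End LogDerivations.

(** * Generators of the localized module and the free case *)

Section Localization.

Variables (K : fieldType) (l : nat).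

Local Notation S := {mpoly K[l]}.
Local Notation V := 'rV[K]_l.
Local Notation arrangement := {fset {vspace V}}.

Lemma central_neq_full (A : arrangement) H :
  central_arrangement A -> H \in A -> H != fullv.
Proof.
move=> hA /hA hH; apply/eqP => Hf.
by move: hH; rewrite Hf dimvf /dim /= mul1n => /eqP; rewrite gtn_eqF.
Qed.

Lemma central_localization (A : arrangement) X :
  central_arrangement A -> central_arrangement (localization A X).
Proof. by move=> hA H; rewrite !inE => /andP[/hA]. Qed.

(** Translation by [p] in [X] fixes the forms of the hyperplanes containing [X], so it preserves
    their conditions. The conditions of the other hyperplanes are forced by the factor [Q], whose
    translate is nonzero at the origin. *)
Lemma localization_generators (A : arrangement) X k (theta : 'M[S]_(k, l)) :
  [pchar K] =i pred0 -> central_arrangement A ->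
  generates (log_derivation A) theta ->
  exists (p : V) (s : S), let theta' := map_mx (translate p) theta in
  [/\ s@_0%MM != 0, forall i, log_derivation (localization A X) (row i theta')
    & forall u, log_derivation (localization A X) u ->
        exists w : 'rV_k, s *: u = w *m theta'].
Proof.
move=> charK hA [logt gent].
pose B := [seq H <- A | ~~ (X <= H)%VS].
have BA H : H \in B -> H \in A by rewrite mem_filter => /andP[].
have [|p pX hp] := @generic_point _ _ B X charK.
  by move=> H; rewrite mem_filter => /andP[].
have [|Q [_ Qdiv Qev]] := @multiple_of_defining_forms _ _ B.
  by move=> H /BA; apply: central_neq_full.
exists p, (translate p Q); split.
- by rewrite translate_at0; apply: Qev.
- move=> i H alpha; rewrite !inE => /andP[HA XH] ha.
  have [q hq] := logt i H alpha HA ha; have [h1 Ha] := ha.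
  exists (translate p q); rewrite -map_row derivation_translate // hq rmorphM /=.
  rewrite (translate_linear_form p h1) (proj1 (Ha p)) ?mpolyC0 ?addr0 //.
  exact: subvP XH _ pX.
- move=> u logu; have [|w hw] := gent (Q *: map_mx (translate (- p)) u).
    move=> H alpha HA ha; have [h1 Ha] := ha.
    rewrite derivation_applyZ derivation_translate //.
    have [XH|XH] := boolP (X <= H)%VS; last first.
      have [|q ->] := Qdiv H alpha _ ha; first by rewrite mem_filter XH.
      by exists (q * translate (- p) (derivation_apply u alpha)); rewrite mulrAC.
    have [|q ->] := logu H alpha _ ha; first by rewrite !inE HA.
    exists (Q * translate (- p) q); rewrite rmorphM /=.
    rewrite (translate_linear_form _ h1) (proj1 (Ha (- p))) ?mpolyC0 ?addr0 ?mulrA //.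
    by rewrite memvN; apply: subvP XH _ pX.
  exists (map_mx (translate p) w); rewrite -map_mxM -hw.
  apply/rowP => j; rewrite !mxE rmorphM /=; congr (_ * _).
  by have := translateK (- p) (u 0 j); rewrite opprK.
Qed.

(** The module contains Q S^l with [Q] nonzero, so it has rank [l] over the fraction field; at most
    [l] generators are then independent. *)
Lemma free_of_few_generators (A : arrangement) r (h : 'M[S]_(r, l)) :
  central_arrangement A -> (r <= l)%N -> generates (log_derivation A) h ->
  free_arrangement A.
Proof.
move=> hA rl [logh genh]; exists r, h; split=> //.
have [|Q [Q0 Qdiv _]] := @multiple_of_defining_forms _ _ A.
  by move=> H; apply: central_neq_full.
have [i|U hU] := @mulmx_rows _ _ _ _ _ (Q%:M : 'M_l) h.
  apply: genh => H alpha HA ha; have [q hq] := Qdiv H alpha HA ha.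
  exists (q * derivation_apply (row i 1%:M) alpha).
  have -> : row i Q%:M = Q *: row i 1%:M
    by apply/rowP => j; rewrite !mxE mulr_natr.
  by rewrite derivation_applyZ [in LHS]hq mulrAC.
pose F := map_mx (tofrac (R := S)).
have rF : row_free (F _ _ h).
  rewrite -row_leq_rank (leq_trans rl) //.
  have E : \rank (F _ _ U *m F _ _ h) = l.
    rewrite /F -map_mxM -hU map_scalar_mx /= -scalemx1.
    by rewrite mxrank_scale_nz ?mxrank1 // tofrac_eq0.
  by rewrite -[X in (X <= _)%N]E mxrankM_maxr.
move=> u uh; have : F _ _ u *m F _ _ h = 0 by rewrite /F -map_mxM uh map_mx0.
move/eqP; rewrite (mulmx_free_eq0 _ rF) => /eqP Fu0.
apply/rowP => i; move/rowP/(_ i): Fu0; rewrite !mxE => /eqP.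
by rewrite tofrac_eq0 => /eqP.
Qed.

(** * Syzygies of the generators and the plus-one generated case *)

Lemma linear_coefM (p q : S) k :
  p@_0%MM = 0 -> (q * p)@_U_(k) = q@_0%MM * p@_U_(k).
Proof.
move=> p0; have hk (f : S) : f@_U_(k) = (f^`M(k))@_0%MM.
  by rewrite mcoeff_deriv add0m mnm0E mulr1n.
by rewrite !hk mderivM mcoeffD !rmorphM /= p0 mulr0 add0r.
Qed.

Lemma syzygies_graded n m (a : 'rV_n) (b : 'rV_m) (h : 'M[S]_(n, m)) :
  graded_mx a b h -> graded_submodule a (fun w => w *m h = 0).
Proof.
move=> gh; split=> [|c u v hu hv|e u hu]; first exact: mul0mx.
  by rewrite mulmxDl -scalemxAl hu hv scaler0 addr0.
by rewrite -(graded_part_mulmx _ _ gh) hu graded_part0.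
Qed.

Lemma plus_one_generated_of_presentation (A : arrangement) (a : 'rV_(1 + l))
    (h : 'M[S]_(1 + l, l)) (e : nat) (g : 'rV[S]_(1 + l)) j0 k :
  graded_mx a (const_mx 0%N : 'rV_l) h -> generates (log_derivation A) h ->
  (forall w : 'rV_(1 + l), w *m h = 0 <-> exists v : 'rV_1, w = v *m g) ->
  graded_mx (const_mx e : 'rV_1) a g -> (forall j, (g 0 j)@_0%MM = 0) ->
  (g 0 j0)@_U_(k) != 0 -> plus_one_generated A.
Proof.
move=> gh [logh genh] syzh gg g0 gk.
have ea : e = (a 0%R j0).+1.
  have [hom _] := gg 0 j0; move/dhomogP: hom => /(_ U_(k)%MM).
  rewrite mcoeff_msupp gk mxE => /(_ isT) /esym; rewrite /= mdeg1.
  by move=> E; rewrite -[LHS](@subnKC (a 0%R j0)) ?E ?addn1 // ltnW // -subn_gt0 E.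
pose s := tperm (lshift l ord0) j0.
have cpK (w : 'rV[S]_(1 + l)) : col_perm s w *m row_perm s h = w *m h.
  by rewrite mul_col_perm -row_permM ?mulgV ?mulVg row_perm1.
have cpE (w : 'rV[S]_(1 + l)) : w = col_perm s (col_perm s^-1%g w).
  by rewrite -col_permM ?mulgV ?mulVg col_perm1.
have sj : s (lshift l ord0) = j0 by rewrite tpermL.
pose d := a 0 j0; pose b := col_perm s a; pose f := col_perm s g.
have Eb : row_mx (const_mx d) (rsubmx b) = b.
  rewrite -[RHS]hsubmxK; congr row_mx; apply/matrixP => x y.
  by rewrite !mxE !ord1 sj.
have Ef : row_mx (const_mx (g 0 j0)) (rsubmx f) = f.
  rewrite -[RHS]hsubmxK; congr row_mx; apply/matrixP => x y.
  by rewrite !mxE !ord1 sj.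
have gj0 : g 0 j0 != 0 by apply: contraNneq gk => ->; rewrite mcoeff0.
exists (rsubmx b), d, (g 0 j0), (rsubmx f), (row_perm s h); split=> //.
rewrite Eb Ef; split.
- move=> i j; have := gg 0 (s j).
  by rewrite !mxE (ord1 i) ea.
- split=> [j i|j]; first by have [] := gh (s j) i; rewrite !mxE subn0.
  have -> : row j (row_perm s h) = row (s j) h by apply/rowP => i; rewrite !mxE.
  exact: logh.
- split=> [u /genh[w ->]|u]; first by exists (col_perm s w); rewrite cpK.
  rewrite (cpE u) cpK syzh; set w := col_perm _ u.
  split=> -[v hv]; exists v.
    by rewrite hv /f !col_permE mulmxA.
  rewrite -[w](col_perm1) -(mulVg s) col_permM hv /f.
  by rewrite !col_permE -!mulmxA -perm_mxM invgK mulVg perm_mx1 mulmx1.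
- move=> v /rowP/(_ (lshift l ord0)); rewrite !mxE big_ord1 !mxE sj => /eqP.
  rewrite mulf_eq0 (negbTE gj0) orbF => /eqP v0.
  by apply/rowP => i; rewrite mxE (ord1 i).
- by move=> i j; rewrite mxE (ord1 i).
Qed.

Lemma plus_one_generated_of_local_presentation (A : arrangement)
    (a : 'rV_(1 + l)) (h theta : 'M[S]_(1 + l, l)) (phi : 'rV[S]_(1 + l))
    (s : S) j k :
  graded_mx a (const_mx 0%N : 'rV_l) h -> generates (log_derivation A) h ->
  (forall w : 'rV_(1 + l), w *m h = 0 -> forall i, (w 0 i)@_0%MM = 0) ->
  (forall i, log_derivation A (row i theta)) -> s@_0%MM != 0 ->
  (forall u, log_derivation A u ->
    exists w : 'rV_(1 + l), s *: u = w *m theta) ->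
  (forall w : 'rV_(1 + l), w *m theta = 0 <-> exists v : 'rV_1, w = v *m phi) ->
  (phi 0 j)@_U_(k) != 0 -> plus_one_generated A.
Proof.
move=> gh [logh genh] minh logt s0 gent syzt phik.
have [U hU] := mulmx_rows (fun i => genh _ (logt i)).
have [i|W hW] := @mulmx_rows _ _ _ _ _ (s *: h) theta.
  by have [w hw] := gent _ (logh i); exists w; rewrite -hw linearZ.
have U0 : (\det U)@_0%MM != 0.
  have := congr1 determinant (minimal_generators_at0 minh hU hW).
  rewrite det_mulmx det_scalar !det_map_mx => E.
  have : (s@_0%MM) ^+ (1 + l) != 0 by rewrite expf_neq0.
  by rewrite -E mulf_eq0 negb_or => /andP[].
have phit : phi *m theta = 0.
  by apply/syzt; exists 1%:M; rewrite mul1mx.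
have gsyz := syzygies_graded gh.
have phiU i : row i (phi *m U) *m h = 0.
  by rewrite -row_mul -mulmxA -hU phit row0.
have detU (w : 'rV_(1 + l)) : w *m h = 0 ->
    exists v : 'rV_1, \det U *: w = v *m (phi *m U).
  move=> wh; have /syzt[v hv] : w *m \adj U *m theta = 0.
    rewrite hU -mulmxA (mulmxA _ U) mul_adj_mx mul_scalar_mx.
    by rewrite -scalemxAr wh scaler0.
  exists v; rewrite mulmxA -hv -mulmxA mul_adj_mx.
  by rewrite mul_mx_scalar.
have [r [e [g [r1 gg [gsy ggen] ming]]]] :=
  minimal_generators gsyz phiU U0 detU.
have [v hv] : exists v : 'M_(1, r), phi *m U = v *m g.
  by have [v hv] := ggen _ (phiU 0); exists v; rewrite -hv row_id.
have phiE : \det U *: phi = v *m g *m \adj U.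
  by rewrite -hv -mulmxA mul_mx_adj mul_mx_scalar.
have g0 i x : (g i x)@_0%MM = 0.
  by have := minh _ (gsy i) x; rewrite mxE.
have [i [x gk]] : exists i x, (g i x)@_U_(k) != 0.
  apply: NNPP => hn; move/eqP: phik; apply.
  have gk i x : (g i x)@_U_(k) = 0.
    by apply/eqP; apply: contraT => gk; case: hn; exists i, x.
  have E := congr1 (fun M : 'rV_(1 + l) => M 0 j) phiE.
  rewrite /= -mulmxA mulmx_sum_row mxE summxE in E.
  have vanish (c : S) i : 
      (c * (g *m \adj U) i j)@_0%MM = 0 /\ (c * (g *m \adj U) i j)@_U_(k) = 0.
    have z : ((g *m \adj U) i j)@_0%MM = 0.
      by rewrite mxE raddf_sum big1 // => x _; rewrite /= rmorphM /= g0 mul0r.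
    rewrite rmorphM /= linear_coefM // z mulr0; split=> //.
    rewrite mxE raddf_sum /= big1 ?mulr0 // => x _.
    by rewrite mulrC linear_coefM // gk mulr0.
  have z : (phi 0 j)@_0%MM = 0.
    have := congr1 (mcoeff 0%MM) E.
    rewrite rmorphM [RHS]raddf_sum [RHS]big1 => [/eqP|i _].
      by rewrite mulf_eq0 (negbTE U0) => /eqP.
    by rewrite mxE [row _ _ _ _]mxE; have [] := vanish (v 0 i) i.
  have := congr1 (mcoeff U_(k)%MM) E.
  rewrite linear_coefM // [RHS]raddf_sum [RHS]big1 => [/eqP|i _].
    by rewrite mulf_eq0 (negbTE U0) => /eqP.
  by rewrite mxE [row _ _ _ _]mxE; have [] := vanish (v 0 i) i.
have r1' : r = 1%N by apply/eqP; rewrite eqn_leq r1 (leq_ltn_trans _ (ltn_ord i)).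
subst r; have e1 : const_mx (e 0 0) = e by apply/rowP => y; rewrite mxE (ord1 y).
apply: (plus_one_generated_of_presentation (g := g) (e := e 0 0) (j0 := x)
  (k := k) gh) => //.
- move=> w; split=> [/ggen //|[c ->]].
  by rewrite -mulmxA -[g](row_id 0) gsy mulmx0.
- by rewrite e1.
- by rewrite -(ord1 i).
Qed.

End Localization.

Theorem theorem5p6 (K : fieldType) (charK : [pchar K] =i pred0) (l : nat)
    (A : {fset {vspace 'rV[K]_l}}) (hA : central_arrangement A)
    (pogA : plus_one_generated A)
    (X : {vspace 'rV[K]_l}) (hX : in_intersection_lattice A X) :
  free_arrangement (localization A X) \/
  plus_one_generated (localization A X).
Proof.
have [d0 [d [alpha [f [theta [alpha0 res]]]]]] := pogA.
have [gphi [homt logt] [gent syzt] _ _] := res.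
have halpha : alpha \is 1.-homog.
  have [] := gphi 0 (lshift l ord0).
  by rewrite !row_mxEl !mxE subSn // subnn.
have [|p [s [s0 logt' gent']]] :=
  @localization_generators K l A X _ theta charK hA; first by split.
set phi := row_mx _ f in gphi syzt.
have [r [a [h [r1 gh genh minh]]]] :=
  minimal_generators (log_derivation_graded (localization A X)) logt' s0 gent'.
have [rl|rl] := leqP r l; [left | right].
  exact: free_of_few_generators (central_localization hA) rl genh.
have {r1 rl} Er : r = (1 + l)%N by apply/eqP; rewrite eqn_leq r1.
subst r; have [k ak] : exists k, alpha@_U_(k) != 0.
  apply: NNPP => hn; move/eqP: alpha0; apply.
  rewrite (linear_form_coef halpha) big1 // => k _.
  have [->|ak] := eqVneq (alpha@_U_(k)) 0; first by rewrite scale0r.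
  by case: hn; exists k.
apply: (plus_one_generated_of_local_presentation (phi := map_mx (translate p) phi)
  (j := lshift l ord0) (k := k) gh genh minh logt' s0 gent').
  have pK q : translate p (translate (- p) q) = q.
    by have := translateK (- p) q; rewrite opprK.
  move=> w; split=> [hw|[v ->]].
    have : map_mx (translate (- p)) w *m theta = 0.
      have := congr1 (map_mx (translate (- p))) hw.
      rewrite map_mxM map_mx0 -map_mx_comp; congr (_ *m _ = _).
      by apply/matrixP => i j; rewrite mxE /= translateK.
    move=> /syzt[v hv]; exists (map_mx (translate p) v).
    rewrite -map_mxM -hv; apply/rowP => i; rewrite !mxE.
    by rewrite /= pK.
  have /syzt : exists v : 'rV_1, phi = v *m phi by exists 1%:M; rewrite mul1mx.
  by move=> E; rewrite -mulmxA -map_mxM E map_mx0 mulmx0.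
rewrite mxE row_mxEl mxE (translate_linear_form _ halpha) mcoeffD mcoeffC.
by rewrite mnm1_eq0 mulr0 addr0.
Qed.
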